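(* Let $K\subseteq\mathbb{R}^d$ be a convex body and let $\nu$ be a probability measure on $\mathbb{R}^d$ with density $f$ whose support is $K$ and with $\inf_{x\in K} f(x)>0$. There is a constant $c=c(K,\nu)$ such that, for any sequence $(r_n)$ with $r_n \geq c\left(\frac{\ln n}{n}\right)^{1/d}$, the random Vietoris--Rips complex $\mathcal{R}(n,r_n)$ is asymptotically almost surely contractible.
   Context: A convex body is a convex, compact set with nonempty interior. The random Vietoris--Rips complex $\mathcal{R}(n,r)$ is constructed by sampling $X_1,\dots,X_n$ i.i.d. according to $\nu$ and declaring a subset of these points a simplex if and only if all its pairwise Euclidean distances are at most $r$. A simplicial complex is contractible if its geometric realization is homotopy equivalent to a point. A sequence of events $E_n$ holds asymptotically almost surely (a.a.s.) if $\Pr(E_n)\to 1$ as $n\to\infty$. *)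

(* Defs.v *)
From mathcomp Require Import all_boot all_order all_algebra all_classical all_reals all_analysis.
Import numFieldNormedType.Exports.
Import Order.TTheory GRing.Theory Num.Theory.

Set Implicit Arguments.
Unset Strict Implicit.
Unset Printing Implicit Defensive.

Local Open Scope classical_set_scope.
Local Open Scope ring_scope.

(* Points of R^d are represented as d-tuples of reals (for the measurable
   structure: the product of Borel sigma-algebras), and sent to row vectors
   'rV[R]_d for topological/linear notions. *)
Definition rv (R : realType) (d : nat) (x : d.-tuple R) : 'rV[R]_d :=
  \row_(i < d) tnth x i.

Definition eucl_dist (R : realType) (d : nat) (x y : d.-tuple R) : R :=
  Num.sqrt (\sum_(i < d) (tnth x i - tnth y i) ^+ 2).

Definition convex_body (R : realType) (d : nat) (K : set 'rV[R]_d) : Prop :=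
  [/\ (forall x y t, K x -> K y -> 0 <= t -> t <= 1 ->
         K ((1 - t) *: x + t *: y)),
      compact K &
      interior K !=set0].

(* lam is the Lebesgue measure on R^d: a measure on the Borel sets of R^d
   giving each half-open box its volume (this determines it uniquely). *)
Definition is_lebesgue_measure (R : realType) (d : nat)
    (lam : {measure set (d.-tuple R) -> \bar R}) : Prop :=
  forall a b : d.-tuple R, (forall i, tnth a i <= tnth b i) ->
    lam [set x | forall i, tnth a i < tnth x i <= tnth b i] =
    (\prod_(i < d) (tnth b i - tnth a i))%:E.

Definition has_density (R : realType) (d : nat)
    (lam : {measure set (d.-tuple R) -> \bar R})
    (nu : probability (d.-tuple R) R) (f : d.-tuple R -> R) : Prop :=
  [/\ measurable_fun setT f,
      (forall x, 0 <= f x) &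
      (forall A, measurable A -> nu A = (\int[lam]_(x in A) (f x)%:E)%E)].

Definition iid_with_law (R : realType) (d : nat)
    (dO : measure_display) (Omega : measurableType dO)
    (P : probability Omega R) (nu : probability (d.-tuple R) R)
    (X : nat -> Omega -> d.-tuple R) : Prop :=
  [/\ (forall i, measurable_fun setT (X i)),
      (forall i A, measurable A -> P (X i @^-1` A) = nu A) &
      (forall (s : seq nat) (A : nat -> set (d.-tuple R)), uniq s ->
         (forall i, measurable (A i)) ->
         P (\bigcap_(i in [set i | i \in s]) (X i @^-1` A i)) =
         (\prod_(i <- s) P (X i @^-1` A i))%E)].

Definition rips_simplex (R : realType) (d n : nat) (pts : 'I_n -> d.-tuple R)
    (r : R) (s : {set 'I_n}) : Prop :=
  s != finset.set0 /\ (forall i j, i \in s -> j \in s -> eucl_dist (pts i) (pts j) <= r).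

(* Geometric realization of a (finite) simplicial complex Delta on vertex set
   'I_n, as a subspace of R^n: barycentric coordinate vectors whose support is
   a simplex of Delta. *)
Definition geom_realization (R : realType) (n : nat)
    (Delta : {set 'I_n} -> Prop) : set 'rV[R]_n :=
  [set t | (forall i, 0 <= t ord0 i) /\ (\sum_(i < n) t ord0 i = 1) /\
           Delta (finset (fun i : 'I_n => t ord0 i != 0))].

Definition contractible (R : realType) (T : topologicalType) (S : set T) : Prop :=
  exists x0, S x0 /\
    exists H : R * T -> T,
      [/\ {within `[0, 1]%classic `*` S, continuous H},
          (forall t x, 0 <= t <= 1 -> S x -> S (H (t, x))) &
          (forall x, S x -> H (0, x) = x /\ H (1, x) = x0)].

Definition rips_contractible_event (R : realType) (d : nat)
    (Omega : Type) (X : nat -> Omega -> d.-tuple R) (n : nat) (r : R) :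
    set Omega :=
  [set w | contractible R
             (@geom_realization R n (rips_simplex (fun i : 'I_n => X (val i) w) r))].

(* Main.v *)
Require Import Defs.
From mathcomp Require Import all_boot all_order all_algebra all_classical all_reals all_analysis.
From mathcomp Require Import measurable_realfun ring lra.
Import numFieldNormedType.Exports.
Import Order.TTheory GRing.Theory Num.Theory.
Set Implicit Arguments.
Unset Strict Implicit.
Unset Printing Implicit Defensive.
Local Open Scope classical_set_scope.
Local Open Scope ring_scope.

(** Fix a ball B(o, rho) inside K.  If every ball of radius delta inside K
  contains a sample point, with delta a small multiple of r (depending only on
  rho and the diameter of K), then the Rips complex collapses to a simplex.
  Remove the vertices in decreasing order of distance to o.  At scale r the body
  may look like a half-space near the farthest vertex v, so v itself need not be
  dominated by another vertex; but its link lies in B(o, |v - o|) and in B(v, r),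
  and can be emptied by edge collapses: with z the point at distance r/4 from v
  towards o, the edge from v to its neighbour u farthest from z is dominated by
  any sample point close to (3u + z)/4, as long as |u - z| > r/2.  Once all
  neighbours of v are within r/2 of z, a sample point near z dominates v.  What
  finally remains lies in B(o, r/2) and spans a simplex.

  For the density of the sample, cut a cube containing K into cells of side
  l = b (ln n / n)^(1/d).  A cell inside K has mass at least m l^d and is missed
  by the sample with probability at most exp(- n m l^d), which is at most n^-2 if
  b is large, and there are O(n / ln n) cells. *)

(** * Flag complexes and the homotopies that collapse them *)

Lemma continuousT_comp_fun (S T U : topologicalType) (f : S -> T) (g : T -> U) :
  continuous f -> continuous g -> continuous (fun x => g (f x)).
Proof. by move=> fc gc x; exact: (continuous_comp (fc x) (gc (f x))). Qed.

Lemma continuousT_pair_fun (S T U : topologicalType) (f : S -> T) (g : S -> U) :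
  continuous f -> continuous g -> continuous (fun x => (f x, g x)).
Proof. by move=> fc gc x; have := cvg_pair (fc x) (gc x); apply. Qed.

Section Dismantling.
Context {R : realType} {n : nat}.
Implicit Types (e : rel 'I_n) (x : 'rV[R]_n) (u v w : 'I_n).

(* Flag complex of e; the vertices i with [e i i = false] do not belong to it. *)
Definition clique_realization e : set 'rV[R]_n :=
  [set x | [/\ forall i, 0 <= x ord0 i, \sum_(i < n) x ord0 i = 1 &
     forall i j, x ord0 i != 0 -> x ord0 j != 0 -> e i j]].

(* The homotopy is continuous on the whole ambient space and starts at the
   identity of that space, so that homotopies can be concatenated without
   gluing continuous functions along closed pieces. *)
Definition globally_contractible e : Prop :=
  exists (x0 : 'rV[R]_n) (H : R * 'rV[R]_n -> 'rV[R]_n),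
  [/\ continuous H, forall x, H (0, x) = x,
      forall t x, 0 <= t <= 1 -> clique_realization e x ->
        clique_realization e (H (t, x)) &
      forall x, clique_realization e x -> H (1, x) = x0].

Definition delete_pair u v e : rel 'I_n :=
  [rel i j | e i j && ~~ (((i == u) && (j == v)) || ((i == v) && (j == u)))].

(* A step removes the edge uv or, when u = v, the vertex u.  Since only cliques
   matter, e' may keep or drop pairs one of whose ends is a deleted vertex. *)
Inductive dismantlable : rel 'I_n -> Prop :=
| DismantlableCone e w : (forall i, e i i -> e i w /\ e w i) -> e w w ->
    dismantlable e
| DismantlableStep e e' u v w : w != u -> w != v -> e w w ->
    (forall i, e i u -> e i v -> e i w /\ e w i) ->
    (forall i j, e' i j -> e i j) ->
    (forall i j, delete_pair u v e i i -> delete_pair u v e j j ->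
       delete_pair u v e i j -> e' i j) ->
    dismantlable e' -> dismantlable e.

(** Adding a vertex adjacent to everything to a clique gives a clique, so the segment from a point
    of the realization to [w] stays inside. *)
Lemma clique_realization_contract e w x t : e w w ->
  (forall i, e i i -> e i w /\ e w i) -> 0 <= t <= 1 ->
  clique_realization e x ->
  clique_realization e ((1 - t) *: x + t *: delta_mx ord0 w).
Proof.
move=> ew ec /andP[t0 t1] [x0 sx ex]; split=> [i||i j].
- rewrite !mxE addr_ge0 ?mulr_ge0 ?subr_ge0 ?x0//.
- under eq_bigr do rewrite !mxE eqxx/=.
  rewrite big_split/= -!mulr_sumr sx mulr1 (bigD1 w)//= eqxx big1 ?addr0.
    by rewrite mulr1 subrK.
  by move=> i /negPf ->.
- rewrite !mxE eqxx/=.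
  have xe k : (1 - t) * x ord0 k + t * (k == w)%:R != 0 -> k = w \/ x ord0 k != 0.
    case: (eqVneq k w) => [->|_]; first by left.
    by rewrite mulr0 addr0 mulf_eq0 => /norP[_]; right.
  move=> /xe[->|xi] /xe[->|xj] //.
  + by case: (ec j (ex _ _ xj xj)).
  + by case: (ec i (ex _ _ xi xi)).
  + exact: ex.
Qed.

Lemma continuous_coord_min u v : continuous (fun x => Num.min (x ord0 u) (x ord0 v)).
Proof.
by move=> x; apply: continuous_min; exact: coord_continuous.
Qed.

(* Direction of the collapse: w receives the mass removed from u and v, in
   proportion to the smaller of the two coordinates. *)
Definition shift_pair u v w : 'rV[R]_n :=
  \sum_(i in [set u; v]%SET) (delta_mx ord0 w - delta_mx ord0 i).

(** The sum runs over a set, so [u = v] counts once: one formula serves both the removal of an edge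
    and the removal of a vertex. *)
Lemma shift_pairE u v w i : w != u -> w != v ->
  shift_pair u v w ord0 i =
    (i == w)%:R * #|[set u; v]%SET|%:R - (i \in [set u; v]%SET)%:R.
Proof.
move=> wu wv; rewrite summxE.
under eq_bigr do rewrite !mxE eqxx/=.
rewrite big_split/= sumr_const mulr_natr; congr (_ + _).
rewrite sumrN; congr (- _).
case: (boolP (i \in _)) => [|]; last first.
  move=> iN; rewrite big1// => j juv; case: eqVneq => // ij.
  by rewrite ij juv in iN.
move=> iuv; rewrite (bigD1 i)//= eqxx big1 ?addr0// => j /andP[_ /negPf].
by rewrite eq_sym => ->.
Qed.

Lemma sum_shift_pair u v w : \sum_i shift_pair u v w ord0 i = 0.
Proof.
under eq_bigr do rewrite summxE.
rewrite exchange_big/= big1// => k _.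
under eq_bigr do rewrite !mxE eqxx/=.
rewrite big_split/= sumrN (bigD1 w)//= eqxx big1 => [|i /negPf->//].
rewrite (bigD1 k)//= eqxx [X in _ - (_ + X)]big1 ?addr0 ?subrr// => i /negPf->//.
Qed.

(** At most the smaller of the two coordinates is removed, so nothing becomes negative. If mass
    moves at all, [u] and [v] are in the support, so every vertex of the support is adjacent to
    both, hence to [w]. *)
Lemma clique_realization_shift e u v w x t : w != u -> w != v -> e w w ->
  (forall i, e i u -> e i v -> e i w /\ e w i) -> 0 <= t <= 1 ->
  clique_realization e x -> clique_realization e
    (x + (t * Num.min (x ord0 u) (x ord0 v)) *: shift_pair u v w).
Proof.
move=> wu wv ew ec /andP[t0 t1] [x0 sx ex].
set m := Num.min _ _.
have m0 : 0 <= m by rewrite le_min !x0.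
have mi i : i \in [set u; v]%SET -> m <= x ord0 i.
  by rewrite !inE => /orP[] /eqP->; rewrite ge_min lexx ?orbT.
have yE i : i != w -> (x + (t * m) *: shift_pair u v w) ord0 i =
    x ord0 i - t * m * (i \in [set u; v]%SET)%:R.
  by move=> /negPf iw; rewrite !mxE shift_pairE// iw mul0r sub0r mulrN.
have wN : w \notin [set u; v]%SET by rewrite !inE negb_or wu.
split=> [i||i j].
- have [->|iw] := eqVneq i w.
    rewrite !mxE shift_pairE// eqxx mul1r (negPf wN) subr0.
    by rewrite addr_ge0 ?mulr_ge0.
  rewrite yE//; case: (boolP (i \in _)) => [iuv|]; last by rewrite mulr0 subr0.
  rewrite mulr1 subr_ge0 (le_trans _ (mi _ iuv))//.
  by rewrite -[leRHS]mul1r ler_wpM2r.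
- under eq_bigr do rewrite mxE [X in _ + X]mxE.
  by rewrite big_split/= -mulr_sumr sum_shift_pair mulr0 addr0.
- have [tm|tm] := eqVneq (t * m) 0; first by rewrite tm scale0r addr0; exact: ex.
  have {tm}mp : 0 < m by rewrite lt_def m0 andbT; apply: contraNneq tm => ->; rewrite mulr0.
  have xu : x ord0 u != 0 by rewrite gt_eqF// (lt_le_trans mp)// mi// !inE eqxx.
  have xv : x ord0 v != 0 by rewrite gt_eqF// (lt_le_trans mp)// mi// !inE eqxx orbT.
  have ye k : (x + (t * m) *: shift_pair u v w) ord0 k != 0 ->
      k = w \/ x ord0 k != 0.
    case: (eqVneq k w) => [->|kw]; first by left.
    rewrite yE//; case: (boolP (k \in _)) => [kuv _|]; last by rewrite mulr0 subr0; right.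
    by right; rewrite gt_eqF// (lt_le_trans mp)// mi.
  have xw k : x ord0 k != 0 -> e k w /\ e w k by move=> xk; apply: ec; exact: ex.
  move=> /ye[->|xi] /ye[->|xj] //.
  + by case: (xw j xj).
  + by case: (xw i xi).
  + exact: ex.
Qed.

(** At time 1 the smaller of the coordinates at [u] and [v] has become zero, so the support no
    longer contains both. *)
Lemma clique_realization_shift1 e u v w x : w != u -> w != v -> e w w ->
  (forall i, e i u -> e i v -> e i w /\ e w i) ->
  clique_realization e x -> clique_realization (delete_pair u v e)
    (x + Num.min (x ord0 u) (x ord0 v) *: shift_pair u v w).
Proof.
move=> wu wv ew ec xe.
have := @clique_realization_shift e u v w x 1 wu wv ew ec _ xe.
rewrite mul1r ler01 lexx => /(_ isT) [y0 sy ye].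
split=> // i j yi yj; rewrite /delete_pair/= ye//=.
have yuv : (x + Num.min (x ord0 u) (x ord0 v) *: shift_pair u v w) ord0 u = 0 \/
    (x + Num.min (x ord0 u) (x ord0 v) *: shift_pair u v w) ord0 v = 0.
  have [xuv|xuv] := leP (x ord0 u) (x ord0 v); [left|right];
  by rewrite !mxE shift_pairE// [in (_ == w)]eq_sym ?(negPf wu) ?(negPf wv) !inE eqxx ?orbT
    mul0r sub0r mulrN1 subrr.
rewrite negb_or; apply/andP; split; apply/negP => /andP[/eqP iE /eqP jE];
by subst i j; case: yuv => yz; [move: yi yj|move: yi yj]; rewrite yz eqxx.
Qed.

Lemma continuous_shift u v w : continuous (fun p : R * 'rV[R]_n =>
  p.2 + (p.1 * Num.min (p.2 ord0 u) (p.2 ord0 v)) *: shift_pair u v w).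
Proof.
move=> p; apply: cvgD; first exact: cvg_snd.
apply: cvgZr_tmp; apply: cvgM; first exact: cvg_fst.
have /= := @continuous_comp _ _ _ (@snd R 'rV[R]_n) _ p _ (@continuous_coord_min u v p.2).
by apply; exact: cvg_snd.
Qed.

Lemma continuous_contract (y : 'rV[R]_n) : continuous (fun p : R * 'rV[R]_n =>
  (1 - p.1) *: p.2 + p.1 *: y).
Proof.
move=> p; apply: cvgD; last by apply: cvgZr_tmp; exact: cvg_fst.
apply: cvgZ; last exact: cvg_snd.
by apply: cvgB; [exact: cvg_cst|exact: cvg_fst].
Qed.

(** Retraction of the line onto the unit interval. With it the concatenation of two homotopies is a
    single formula, continuous everywhere. *)
Definition clamp (t : R) : R := Num.min 1 (Num.max 0 t).

Lemma clamp_itv t : 0 <= clamp t <= 1.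
Proof. by rewrite /clamp le_min ler01 le_max lexx ge_min lexx. Qed.

Lemma clamp_le0 t : t <= 0 -> clamp t = 0.
Proof. by move=> t0; rewrite /clamp max_l// min_r. Qed.

Lemma clamp_ge1 t : 1 <= t -> clamp t = 1.
Proof.
by move=> t1; rewrite /clamp max_r ?(le_trans _ t1)// min_l.
Qed.

Lemma continuous_clamp : continuous clamp.
Proof.
move=> t; apply: continuous_min; first exact: cvg_cst.
by apply: continuous_max; [exact: cvg_cst|exact: cvg_id].
Qed.

Lemma dismantlable_contractible e :
  dismantlable e -> globally_contractible e.
Proof.
elim=> {}e.
  move=> w ec ew; exists (delta_mx ord0 w),
    (fun p => (1 - p.1) *: p.2 + p.1 *: delta_mx ord0 w); split.
  - exact: continuous_contract.
  - by move=> x; rewrite /= subr0 scale1r scale0r addr0.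
  - by move=> t x t01; exact: clique_realization_contract.
  - by move=> x _; rewrite /= subrr scale0r scale1r add0r.
move=> e' u v w wu wv ew ec e'_sub e'E _ [x0 [G [Gc G0 Ge G1]]].
pose H := (fun p : R * 'rV[R]_n =>
  p.2 + (p.1 * Num.min (p.2 ord0 u) (p.2 ord0 v)) *: shift_pair u v w).
have e'e x : clique_realization e' x -> clique_realization e x.
  by move=> [? ? xe]; split=> // i j xi xj; apply: e'_sub; exact: xe.
have H1 x : clique_realization e x -> clique_realization e' (H (1, x)).
  move=> /clique_realization_shift1 - /(_ _ _ _ wu wv ew ec) [? ? xe].
  by rewrite /H mul1r; split=> // i j xi xj; apply: e'E; exact: xe.
(* The first half of the time collapses onto [e']; in the second half [H] rests at time 1 and [G]
   contracts what is left. *)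
exists x0, (fun p => G (clamp (2 * p.1 - 1), H (clamp (2 * p.1), p.2))); split.
- have c1 : continuous (fun p : R * 'rV[R]_n => clamp (2 * p.1 - 1)).
    apply: (continuousT_comp_fun (f := fun p : R * 'rV[R]_n => 2 * p.1 - 1)); last exact: continuous_clamp.
    move=> p; apply: cvgB; last exact: cvg_cst.
    by apply: cvgMl_tmp; exact: cvg_fst.
  have c2 : continuous (fun p : R * 'rV[R]_n => clamp (2 * p.1)).
    apply: (continuousT_comp_fun (f := fun p : R * 'rV[R]_n => 2 * p.1)); last exact: continuous_clamp.
    by move=> p; apply: cvgMl_tmp; exact: cvg_fst.
  have c3 : continuous (fun p : R * 'rV[R]_n => H (clamp (2 * p.1), p.2)).
    apply: (continuousT_comp_fun (f := fun p : R * 'rV[R]_n => (clamp (2 * p.1), p.2))).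
      by apply: continuousT_pair_fun => //; move=> p; exact: cvg_snd.
    exact: (continuous_shift (u := u) (v := v) (w := w)).
  apply: (continuousT_comp_fun (f := fun p : R * 'rV[R]_n =>
    (clamp (2 * p.1 - 1), H (clamp (2 * p.1), p.2)))) => //.
  exact: continuousT_pair_fun.
- move=> x /=; rewrite mulr0 sub0r !clamp_le0 ?lerN10// G0.
  by rewrite /H/= mul0r scale0r addr0.
- move=> t x t01 xe /=; have [t2|t2] := leP (2 * t) 1.
    rewrite (clamp_le0 (t := 2 * t - 1)) ?subr_le0// G0.
    by apply: clique_realization_shift => //; exact: clamp_itv.
  rewrite (clamp_ge1 (ltW t2)); apply: e'e; apply: Ge; first exact: clamp_itv.
  exact: H1.
- move=> x xe /=; rewrite !clamp_ge1; [|lra|lra].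
  by apply: G1; exact: H1.
Qed.

Lemma dismantlable_vertex e : dismantlable e -> exists w, e w w.
Proof. by elim=> {}e; [move=> w _ ew; exists w|move=> e' u v w _ _ ew *; exists w]. Qed.

(** [globally_contractible] also holds for an empty realization; the vertex [w], carried to [x0] at
    time 1, shows that [x0] belongs to the realization. *)
Lemma globally_contractible_contractible e w : e w w ->
  globally_contractible e -> contractible R (clique_realization e).
Proof.
move=> ew [x0 [H [Hc H0 He H1]]]; exists x0; split.
  have we : clique_realization e (delta_mx ord0 w).
    split=> [i||i j].
    - by rewrite mxE; case: andP.
    - by rewrite (bigD1 w)//= mxE !eqxx big1 ?addr0// => i /negPf iw; rewrite mxE iw andbF.
    - rewrite !mxE eqxx/=; case: (eqVneq i w) => [->|]; last by rewrite eqxx.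
      by case: (eqVneq j w) => [->|]; last by rewrite eqxx.
  by rewrite -(H1 _ we); apply: He => //; rewrite ler01 lexx.
exists H; split.
- exact: continuous_subspaceT.
- by move=> t x; exact: He.
- by move=> x xe; rewrite H0 (H1 _ xe).
Qed.

End Dismantling.

(** * Euclidean norm, convexity and balls *)

Section EuclideanNorm.
Context {R : realType} {d : nat}.
Implicit Types x y z : 'rV[R]_d.

(** The standing norm on row vectors is the supremum norm; distances in the Rips complex are
    Euclidean. *)
Definition enorm x : R := Num.sqrt (\sum_(i < d) (x ord0 i) ^+ 2).

Lemma enorm_ge0 x : 0 <= enorm x. Proof. exact: sqrtr_ge0. Qed.

Lemma enorm_sqr x : enorm x ^+ 2 = \sum_(i < d) (x ord0 i) ^+ 2.
Proof. by rewrite sqr_sqrtr// sumr_ge0// => i _; rewrite sqr_ge0. Qed.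

Lemma enormZ (a : R) x : enorm (a *: x) = `|a| * enorm x.
Proof.
rewrite /enorm -sqrtr_sqr -sqrtrM ?sqr_ge0// mulr_sumr.
by congr Num.sqrt; apply: eq_bigr => i _; rewrite mxE exprMn.
Qed.

Lemma enormN x : enorm (- x) = enorm x.
Proof. by rewrite -scaleN1r enormZ normrN1 mul1r. Qed.

Lemma enormB x y : enorm (x - y) = enorm (y - x).
Proof. by rewrite -enormN opprB. Qed.

Lemma enorm_coord x i : `|x ord0 i| <= enorm x.
Proof.
rewrite -sqrtr_sqr /enorm ler_sqrt; last by rewrite sumr_ge0// => j _; rewrite sqr_ge0.
by rewrite (bigD1 i)//= lerDl sumr_ge0// => j _; rewrite sqr_ge0.
Qed.

(** Cauchy-Schwarz, by expanding the squared norm of b x - a y, with a and b the norms of x and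
    y. *)
Lemma enorm_dot x y : \sum_i x ord0 i * y ord0 i <= enorm x * enorm y.
Proof.
set a := enorm x; set b := enorm y.
have [a0|a0] := eqVneq a 0.
  rewrite a0 mul0r big1// => i _; have := enorm_coord x i.
  by rewrite -/a a0 normr_le0 => /eqP ->; rewrite mul0r.
have [b0|b0] := eqVneq b 0.
  rewrite b0 mulr0 big1// => i _; have := enorm_coord y i.
  by rewrite -/b b0 normr_le0 => /eqP ->; rewrite mulr0.
have ab : 0 < a * b by rewrite mulr_gt0// lt_def ?a0 ?b0 enorm_ge0.
have : 0 <= \sum_i (b * x ord0 i - a * y ord0 i) ^+ 2.
  by rewrite sumr_ge0// => i _; rewrite sqr_ge0.
rewrite (eq_bigr (fun i => b ^+ 2 * x ord0 i ^+ 2 + a ^+ 2 * y ord0 i ^+ 2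
   - (2 * (a * b)) * (x ord0 i * y ord0 i))); last by move=> i _; ring.
rewrite sumrB big_split/= -!mulr_sumr -!enorm_sqr -/a -/b => h.
rewrite -(ler_pM2l ab); nra.
Qed.

Lemma enormD x y : enorm (x + y) <= enorm x + enorm y.
Proof.
rewrite -(ler_pXn2r (n := 2))// ?nnegrE ?addr_ge0 ?enorm_ge0//.
rewrite enorm_sqr.
under eq_bigr do rewrite mxE sqrrD -mulr_natr mulrC.
have := enorm_dot x y.
rewrite 2!big_split/= -mulr_sumr -!enorm_sqr sqrrD -mulr_natr; lra.
Qed.

Lemma enorm_tri z x y : enorm (x - y) <= enorm (x - z) + enorm (z - y).
Proof. by rewrite -[x - y](subrKA z) enormD. Qed.

(* Stewart's theorem *)
Lemma enorm_convex_sqr (k : R) x y z :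
  enorm (x - ((1 - k) *: y + k *: z)) ^+ 2 =
  (1 - k) * enorm (x - y) ^+ 2 + k * enorm (x - z) ^+ 2
  - k * (1 - k) * enorm (y - z) ^+ 2.
Proof.
rewrite !enorm_sqr !mulr_sumr -big_split/= -sumrB.
by apply: eq_bigr => i _; rewrite !mxE; ring.
Qed.

Lemma enorm_convex (k : R) x y z : 0 <= k <= 1 ->
  enorm ((1 - k) *: x + k *: y - z) <= (1 - k) * enorm (x - z) + k * enorm (y - z).
Proof.
move=> /andP[k0 k1].
have -> : (1 - k) *: x + k *: y - z = (1 - k) *: (x - z) + k *: (y - z).
  by apply/rowP => i; rewrite !mxE; ring.
by rewrite (le_trans (enormD _ _))// !enormZ !ger0_norm ?subr_ge0.
Qed.

Lemma enorm_convexl (k : R) x y :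
  enorm ((1 - k) *: x + k *: y - x) = `|k| * enorm (y - x).
Proof. by rewrite -enormZ; congr enorm; apply/rowP => i; rewrite !mxE; ring. Qed.

Lemma enorm_convexr (k : R) x y :
  enorm ((1 - k) *: x + k *: y - y) = `|1 - k| * enorm (x - y).
Proof. by rewrite -enormZ; congr enorm; apply/rowP => i; rewrite !mxE; ring. Qed.

Definition convex_subset (K : set 'rV[R]_d) : Prop :=
  forall x y t, K x -> K y -> 0 <= t -> t <= 1 -> K ((1 - t) *: x + t *: y).

Definition eball x (e : R) : set 'rV[R]_d := [set y | enorm (y - x) <= e].

(** The new ball is the image of the ball around [y] under the homothety of centre [x] and ratio
    [k]; convexity keeps each image point in [K]. *)
Lemma convex_eball K x y (k e : R) : convex_subset K -> K x -> eball y e `<=` K ->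
  0 < k <= 1 -> eball ((1 - k) *: x + k *: y) (k * e) `<=` K.
Proof.
move=> Kc Kx Ky /andP[k0 k1] z /= zle.
have -> : z = (1 - k) *: x + k *: (y + k^-1 *: (z - ((1 - k) *: x + k *: y))).
  by apply/rowP => i; rewrite !mxE; field; rewrite gt_eqF.
apply: Kc => //; last exact: ltW.
apply: Ky; rewrite /eball/= addrC addKr enormZ ger0_norm ?invr_ge0 ?(ltW k0)//.
by rewrite ler_pdivrMl.
Qed.

End EuclideanNorm.

(** * Dismantling the Rips complex of a dense sample *)

Section RipsDismantlable.
Context {R : realType} {d n : nat} (p : 'I_n -> 'rV[R]_d).
Variables (K : set 'rV[R]_d) (o : 'rV[R]_d) (rho D r : R).
Hypotheses (Kconvex : convex_subset K) (rho_gt0 : 0 < rho) (r_gt0 : 0 < r).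
Hypotheses (oK : eball o rho `<=` K) (Ko : K `<=` eball o D) (rhoD : rho <= D).
Hypothesis Kp : forall i, K (p i).
(** The factor 32 serves two bounds: [delta] is at most r/32, as [rho <= D], and [4 * delta] is at
    most [mu * rho], as every vertex is within [D] of [o]. *)
Let delta : R := rho / (32 * D) * r.
Hypothesis dense : forall c, eball c delta `<=` K -> exists i, eball c delta (p i).

Let D_gt0 : 0 < D. Proof. exact: lt_le_trans rhoD. Qed.

Let delta_le : delta <= r / 32.
Proof.
rewrite /delta mulrC ler_pM2l// ler_pdivrMr ?mulr_gt0//.
by rewrite mulrA mulVf// mul1r.
Qed.

Let delta_gt0 : 0 < delta.
Proof. by rewrite /delta !mulr_gt0// invr_gt0 mulr_gt0. Qed.

Section Center.
Variable v : 'I_n.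
Let L := enorm (p v - o).
Hypothesis vr : r / 2 < L.
Let mu := r / (4 * L).
Definition link_center : 'rV[R]_d :=
  (1 - r / (4 * enorm (p v - o))) *: p v + (r / (4 * enorm (p v - o))) *: o.
Let z := link_center.

Let L_gt0 : 0 < L. Proof. by rewrite (lt_trans _ vr)// divr_gt0. Qed.

Let muL : mu * L = r / 4.
Proof. by rewrite /mu; field; rewrite gt_eqF. Qed.

Let mu_gt0 : 0 < mu. Proof. by rewrite /mu divr_gt0// mulr_gt0. Qed.

Let mu_le1 : mu <= 1.
Proof. by rewrite -(ler_pM2r L_gt0) muL mul1r; move: vr r_gt0; lra. Qed.

Lemma link_center_vertex : enorm (p v - z) = r / 4.
Proof.
rewrite [LHS]enormB [LHS]enorm_convexl (enormB o) -/L -/mu.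
by rewrite ger0_norm ?muL// ltW.
Qed.

Lemma link_center_origin : enorm (z - o) = L - r / 4.
Proof.
by rewrite enorm_convexr -/L -/mu ger0_norm ?subr_ge0// mulrBl mul1r muL.
Qed.

Let delta_mu : 4 * delta <= mu * rho.
Proof.
have LD : L <= D by apply: Ko; exact: Kp.
rewrite /delta (_ : mu * rho = r * rho / (4 * L)); last by rewrite /mu mulrAC.
rewrite ler_pdivlMr ?mulr_gt0//.
have -> : 4 * (rho / (32 * D) * r) * (4 * L) = (r * rho) * (16 * L / (32 * D)).
  by field; rewrite gt_eqF.
rewrite ler_piMr ?mulr_ge0 ?(ltW r_gt0) ?(ltW rho_gt0)//.
rewrite ler_pdivrMr ?mulr_gt0//; move: LD D_gt0; lra.
Qed.

(** The homothety of centre [p v] and ratio [mu] maps the ball of radius [rho] around [o] to one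
    around [z]. The factor 4 leaves a ball of radius [delta] at a quarter of the way from any point
    of [K] to [z]. *)
Lemma link_center_ball : eball z (4 * delta) `<=` K.
Proof.
apply: (@subset_trans _ (eball z (mu * rho))) => [y /= /le_trans|]; first exact.
by apply: convex_eball => //; rewrite mu_gt0.
Qed.

Lemma near_link_center : exists w, [/\ enorm (p w - z) <= delta,
  enorm (p w - o) < L & enorm (p w - p v) <= r].
Proof.
have [|w /= wz] := @dense z.
  apply: (subset_trans _ link_center_ball) => y /= /le_trans; apply.
  by rewrite ler_peMl ?(ltW delta_gt0)//; lra.
have {}wz : enorm (p w - z) <= delta := wz.
exists w; split=> //.
  have := enorm_tri z (p w) o; rewrite link_center_origin; move: delta_le delta_gt0 r_gt0 vr L_gt0; lra.
have := enorm_tri z (p w) (p v); rewrite (enormB z) link_center_vertex; move: delta_le delta_gt0 r_gt0 vr L_gt0; lra.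
Qed.

(** The sample point [w] is taken near c = (3u + z)/4. Moving a quarter of the way to [z] lowers the
    bound [L] on the distance to [o] by r/16, more than [delta]. The bound r/4 on the distance to
    [z] later tells [w] from [v]. *)
Lemma near_link_point (u : 'I_n) : enorm (p u - o) <= L -> enorm (p u - p v) <= r ->
  r / 2 < enorm (p u - z) -> exists w,
  [/\ enorm (p w - o) < L, enorm (p w - p v) <= r,
    r / 4 < enorm (p w - z), enorm (p w - z) < enorm (p u - z) &
    forall i, enorm (p i - z) <= enorm (p u - z) -> enorm (p i - p u) <= r ->
      enorm (p i - p w) <= r].
Proof.
move=> uo uv uz.
set c := (1 - 1 / 4) *: p u + (1 / 4) *: z.
have k01 : 0 <= (1 / 4 : R) <= 1 by apply/andP; split; move: delta_le delta_gt0 r_gt0 vr L_gt0; lra.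
have [|w /= wc] := @dense c.
  have -> : delta = 1 / 4 * (4 * delta) by field.
  by apply: convex_eball => //; [exact: link_center_ball|apply/andP; split; move: delta_le delta_gt0 r_gt0 vr L_gt0; lra].
have {}wc : enorm (p w - c) <= delta := wc.
have uz_le : enorm (p u - z) <= 5 * r / 4.
  by have := enorm_tri (p v) (p u) z; rewrite link_center_vertex; move: delta_le delta_gt0 r_gt0 vr L_gt0; lra.
exists w; split.
- have := enorm_tri c (p w) o; have := enorm_convex (p u) z o k01.
  rewrite -/c link_center_origin; move: delta_le delta_gt0 r_gt0 vr L_gt0; lra.
- have := enorm_tri c (p w) (p v); have := enorm_convex (p u) z (p v) k01.
  rewrite -/c (enormB z) link_center_vertex; move: delta_le delta_gt0 r_gt0 vr L_gt0; lra.
- have := enorm_tri (p w) c z; rewrite (enormB c (p w)).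
  rewrite [enorm (c - z)]enorm_convexr ger0_norm; move: delta_le delta_gt0 r_gt0 vr L_gt0; lra.
- have := enorm_tri c (p w) z.
  rewrite [enorm (c - z)]enorm_convexr ger0_norm; move: delta_le delta_gt0 r_gt0 vr L_gt0; lra.
(* Stewart's formula bounds the square by 3/4 r^2 + 1/16 e^2 with e = |u - z| <= 5r/4, that is by
   217/256 r^2, below the square of 15r/16. The remaining r/16 absorbs [delta]. *)
- move=> i iz iu; have ic : enorm (p i - c) <= 15 / 16 * r.
    have r15 : 0 <= 15 / 16 * r by move: r_gt0; lra.
    rewrite -(ler_pXn2r (n := 2))// ?nnegrE ?enorm_ge0//.
    rewrite enorm_convex_sqr.
    have := enorm_ge0 (p i - p u); have := enorm_ge0 (p i - z).
    move: (enorm (p i - z)) (enorm (p i - p u)) (enorm (p u - z)) iz iu uz uz_le.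
    move=> a b e ae br re er a0 b0.
    have h1: b ^+ 2 <= r ^+ 2 by rewrite ler_pXn2r// ?nnegrE// ltW.
    have h2 : a ^+ 2 <= e ^+ 2 by rewrite ler_pXn2r// ?nnegrE//; move: delta_le delta_gt0 r_gt0 vr L_gt0; lra.
    have h3 : e ^+ 2 <= (5 * r / 4) ^+ 2.
      by rewrite ler_pXn2r// ?nnegrE//; move: delta_le delta_gt0 r_gt0 vr L_gt0; lra.
    move: h3; rewrite !exprMn; have := sqr_ge0 r; move: delta_le delta_gt0 r_gt0 vr L_gt0; lra.
  have := enorm_tri c (p i) (p w); rewrite (enormB c (p w)); move: delta_le delta_gt0 r_gt0 vr L_gt0; lra.
Qed.
End Center.

Implicit Types (A B : {set 'I_n}) (i j u v w : 'I_n).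

Definition rips_on (A : {set 'I_n}) : rel 'I_n :=
  [rel i j | [&& i \in A, j \in A & enorm (p i - p j) <= r]].

(* The Rips graph on A in which only the neighbours of v in B are kept. *)
Definition rips_on_link (A : {set 'I_n}) (v : 'I_n) (B : {set 'I_n}) : rel 'I_n :=
  [rel i j | [&& (i == v) ==> (j \in B), (j == v) ==> (i \in B) & rips_on A i j]].

Lemma rips_on_sym A i j : rips_on A i j = rips_on A j i.
Proof. by rewrite /rips_on/= enormB andbCA. Qed.

Lemma rips_on_refl A i : i \in A -> rips_on A i i.
Proof.
move=> iA; rewrite /rips_on/= iA/=.
by rewrite subrr -(scale0r (0 : 'rV[R]_d)) enormZ normr0 mul0r ltW.
Qed.

Lemma rips_on_link_sym A v B i j : rips_on_link A v B i j = rips_on_link A v B j i.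
Proof. by rewrite /rips_on_link/= andbCA rips_on_sym. Qed.

Lemma rips_on_link_delete_edge A v B u i j : v \in B -> u != v ->
  rips_on_link A v (B :\ u)%SET i j = delete_pair v u (rips_on_link A v B) i j.
Proof.
move=> vB uv; rewrite /delete_pair /rips_on_link/= !finset.in_setD1.
case: (eqVneq i v) => [->|iv]; case: (eqVneq j v) => [->|jv];
  rewrite ?vB ?(eq_sym v) ?uv ?(negPf uv)/= ?andbF ?andbT ?orbF//=.
- by rewrite andbC -!andbA; do !bool_congr.
- by rewrite andbC -!andbA; do !bool_congr.
Qed.

Lemma rips_on_delete_vertex A v i j : i != v -> j != v ->
  rips_on (A :\ v)%SET i j = rips_on A i j.
Proof. by move=> iv jv; rewrite /rips_on/= !finset.in_setD1 iv jv. Qed.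

(** Induction on the size of [B], the neighbours of [v] still present, [v] included. The closure
    condition, [Bdown] below, lets one move towards the link centre among points strictly closer to
    [o] than [v]. It survives the removal of a point farthest from that centre and keeps the
    dominating sample points in [B]. *)
Lemma dismantlable_rips_on_link A v B : v \in A -> v \in B -> B \subset A ->
  r / 2 < enorm (p v - o) ->
  (forall i, i \in A -> enorm (p i - o) <= enorm (p v - o)) ->
  (forall i, enorm (p i - o) < enorm (p v - o) -> i \in A) ->
  (forall i, i \in B -> enorm (p i - p v) <= r) ->
  (forall i j, j \in B -> enorm (p i - o) < enorm (p v - o) ->
    enorm (p i - p v) <= r ->
    enorm (p i - link_center v) < enorm (p j - link_center v) -> i \in B) ->
  dismantlable (rips_on (A :\ v)%SET) -> dismantlable (rips_on_link A v B).
Proof.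
move=> vA; have [m] := ubnP #|B|; elim: m B => // m IH B Bm vB BA vr vmax Adown Br Bdown Av.
have vz := link_center_vertex vr.
have linkE i j : rips_on_link A v B i j =
  [&& (i == v) ==> (j \in B), (j == v) ==> (i \in B) & rips_on A i j] by [].
have w_refl w : w \in A -> w != v -> rips_on_link A v B w w.
  by move=> wA wv; rewrite linkE (negPf wv) rips_on_refl.
have w_adj i w : i \in A -> w \in A -> w \in B -> w != v -> enorm (p i - p w) <= r ->
    rips_on_link A v B i w /\ rips_on_link A v B w i.
  move=> iA wA wB wv iw; rewrite (rips_on_link_sym _ _ _ w i) linkE (negPf wv) wB implybT/=.
  by rewrite /rips_on/= iA wA iw.
have nbrP i : rips_on_link A v B i v -> i \in B.
  by rewrite linkE eqxx => /and3P[].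
(* If all of [B] is within r/2 of the link centre, a sample point near the centre is within r/2 +
   [delta] of all of [B] and dominates [v]; deleting [v] is the step for the pair [v], [v]. *)
have [Bz|] := boolP [forall u in B, enorm (p u - link_center v) <= r / 2].
  have [w [wz wo wv]] := near_link_center vr.
  have wA := Adown _ wo.
  have wz' : enorm (p w - link_center v) < r / 4 by move: delta_le r_gt0; lra.
  have wB : w \in B by apply: (Bdown _ v) => //; rewrite vz.
  have wNv : w != v by apply: contraTneq wz' => ->; rewrite vz ltxx.
  apply: (DismantlableStep wNv wNv _ _ _ _ Av) => [|i /nbrP iB _|i j|i j].
  - exact: w_refl.
  - apply: w_adj => //; first exact: (fintype.subsetP BA).
    have := enorm_tri (link_center v) (p i) (p w); rewrite (enormB (link_center v)).
    by have := forall_inP Bz _ iB; move: r_gt0; lra.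
  - rewrite /rips_on/= !finset.in_setD1 => /and3P[/andP[iv iA] /andP[jv jA] ij].
    by rewrite linkE (negPf iv) (negPf jv)/= /rips_on/= iA jA.
  - have vN k : delete_pair v v (rips_on_link A v B) k k -> k != v.
      by rewrite /delete_pair/=; case: eqVneq; rewrite ?andbF.
    by move=> /vN iv /vN jv /andP[]; rewrite linkE => /and3P[_ _ ij] _; rewrite rips_on_delete_vertex.
move=> /forall_inPn[u0 u0B]; rewrite -real_ltNge ?num_real// => u0z.
(* As [u] is farthest from the link centre, each common neighbour of [u] and [v] is no farther,
   which makes [w] adjacent to it. *)
have [u uB umax] := @arg_maxP _ _ _ u0 (mem B) (fun i => enorm (p i - link_center v)) u0B; have {}uB : u \in B := uB.
have uz : r / 2 < enorm (p u - link_center v) by apply: lt_le_trans (umax _ u0B).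
have uA : u \in A by exact: (fintype.subsetP BA).
have uv : u != v.
  by apply: contraTneq uz => ->; rewrite vz -leNgt; move: r_gt0; lra.
have [w [wo wv wz wu wP]] := near_link_point vr (vmax _ uA) (Br _ uB) uz.
have wA := Adown _ wo.
have wB : w \in B by exact: (Bdown _ u).
have wNv : w != v by apply: contraTneq wz => ->; rewrite vz ltxx.
have wNu : w != u by apply: contraTneq wu => ->; rewrite ltxx.
have BuA : (B :\ u)%SET \subset A by rewrite (fintype.subset_trans _ BA)// finset.subD1set.
apply: (DismantlableStep wNv wNu (e' := rips_on_link A v (B :\ u)%SET)) => [|i|i j|i j _ _|].
- exact: w_refl.
- move=> /nbrP iB; rewrite linkE => /and3P[_ _ /and3P[iA _ iu]].
  by apply: w_adj => //; apply: wP => //; exact: umax.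
- by rewrite rips_on_link_delete_edge// => /andP[].
- by rewrite rips_on_link_delete_edge.
- apply: IH => //.
  + by rewrite -ltnS (leq_trans _ Bm)// ltnS [ltnRHS](cardsD1 u) uB.
  + by rewrite finset.in_setD1 eq_sym uv.
  + by move=> i; rewrite finset.in_setD1 => /andP[_]; exact: Br.
  + move=> i j; rewrite !finset.in_setD1 => /andP[ju jB] io iv ij.
    rewrite (Bdown i j)// andbT; apply: contraTneq ij => ->.
    by rewrite -leNgt; exact: umax.
Qed.

(** Induction on the size of [A]. Closure towards [o] survives the removal of a farthest vertex [v],
    and it puts into [A] every sample point strictly nearer to [o] than [v]. *)
Lemma dismantlable_rips_on A : A != finset.set0 ->
  (forall i j, j \in A -> enorm (p i - o) < enorm (p j - o) -> i \in A) ->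
  dismantlable (rips_on A).
Proof.
have [m] := ubnP #|A|; elim: m A => // m IH A Am /finset.set0Pn[v0 v0A] Adown.
have [v vA vmax] := @arg_maxP _ _ _ v0 (mem A) (fun i => enorm (p i - o)) v0A; have {}vA : v \in A := vA.
have [vr|vr] := leP (enorm (p v - o)) (r / 2).
  apply: (DismantlableCone (w := v)); last exact: rips_on_refl.
  move=> i /and3P[iA _ _]; rewrite (rips_on_sym _ v i).
  suff: rips_on A i v by [].
  rewrite /rips_on/= iA vA/=; have := vmax _ iA => /=.
  have := enorm_tri o (p i) (p v); rewrite (enormB o); lra.
have Adown' i : enorm (p i - o) < enorm (p v - o) -> i \in A by exact: Adown.
pose B := [set i in A | enorm (p i - p v) <= r]%SET.
have BE i : (i \in B) = (i \in A) && (enorm (p i - p v) <= r) by rewrite finset.inE.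
(* Initially [B] contains all neighbours of [v], so the restriction to [B] removes nothing. *)
have -> : rips_on A = rips_on_link A v B.
  apply/funext => i; apply/funext => j; rewrite /rips_on_link/=.
  case: (boolP (rips_on A i j)) => [/and3P[iA jA ij]|_]; last by rewrite !andbF.
  rewrite !BE iA jA/= andbT; symmetry; apply/andP; split; apply/implyP => /eqP <- //.
  by rewrite enormB.
apply: dismantlable_rips_on_link => //.
- by have := rips_on_refl vA; rewrite BE /rips_on/= => /andP[->].
- by apply/fintype.subsetP => i; rewrite BE => /andP[].
- by move=> i; rewrite BE => /andP[].
- by move=> i j _ io iv _; rewrite BE iv Adown'.
apply: IH.
- by rewrite -ltnS (leq_trans _ Am)// ltnS [ltnRHS](cardsD1 v) vA.
- have [w [_ wo _]] := near_link_center vr.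
  apply/finset.set0Pn; exists w; rewrite finset.in_setD1 Adown' ?andbT//.
  by apply: contraTneq wo => ->; rewrite ltxx.
- move=> i j; rewrite !finset.in_setD1 => /andP[jv jA] ij.
  rewrite (Adown i j)// andbT; apply: contraTneq ij => ->.
  by rewrite -leNgt; exact: vmax.
Qed.
End RipsDismantlable.

(** * From grid cells to contractibility of the sampled complex *)

Lemma eucl_dist_enorm (R : realType) d (x y : d.-tuple R) :
  eucl_dist x y = enorm (rv x - rv y).
Proof. by congr Num.sqrt; apply: eq_bigr => i _; rewrite !mxE. Qed.

Lemma geom_realization_rips (R : realType) d n (pts : 'I_n -> d.-tuple R) (r : R) :
  @geom_realization R n (rips_simplex pts r) =
  clique_realization (fun i j => eucl_dist (pts i) (pts j) <= r).
Proof.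
apply/seteqP; split=> [x [x0 [sx [_ ex]]]|x [x0 sx ex]]; split=> //.
  by move=> i j xi xj; apply: ex; rewrite finset.inE.
split=> //; split; last by move=> i j; rewrite !finset.inE; exact: ex.
apply/finset.set0Pn; apply/existsP; apply: contraPT sx => /existsPn xN.
rewrite big1; first by apply/eqP; rewrite eq_sym oner_eq0.
by move=> i _; have := xN i; rewrite finset.inE negbK => /eqP.
Qed.

Lemma enorm_le_coord (R : realType) d (x : 'rV[R]_d) (e : R) :
  (forall i, `|x ord0 i| <= e) -> enorm x <= d%:R * e.
Proof.
move=> xe; have [e0|e0] := ltP e 0.
  case: d x xe => [x _|d x /(_ ord0)]; first by rewrite /enorm big_ord0 sqrtr0 mul0r.
  by move=> /le_lt_trans /(_ e0); rewrite ltNge normr_ge0.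
have de : 0 <= d%:R * e by rewrite mulr_ge0.
rewrite -(ler_pXn2r (n := 2))// ?nnegrE ?enorm_ge0// enorm_sqr.
apply: (@le_trans _ _ (\sum_(i < d) e ^+ 2)).
  by apply: ler_sum => i _; rewrite -[leLHS]real_normK ?num_real// ler_pXn2r ?nnegrE.
rewrite sumr_const card_ord -[leLHS]mulr_natl exprMn ler_wpM2r ?sqr_ge0//.
case: d {x xe de} => [|d]; first by rewrite expr0n.
by rewrite -[leLHS]mulr1 expr2 ler_wpM2l ?ler1n.
Qed.

Lemma convex_body_bounds (R : realType) d (K : set 'rV[R]_d) : convex_body K ->
  exists o rho D M, [/\ 0 < rho <= D, eball o rho `<=` K, K `<=` eball o D, 0 < M &
    forall y, K y -> forall i, `|y ord0 i| <= M].
Proof.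
move=> [_ Kc [ o oK]].
have [e e0 eK] : exists2 e : R, 0 < e & ball o e `<=` K by apply/nbhs_ballP.
have [M KM] : exists M, forall y, K y -> `|y| <= M.
  have [M0 [_ KM]] := compact_bounded Kc.
  by exists (M0 + 1) => y; apply: KM; rewrite ltrDl.
have M1 y : K y -> forall i, `|y ord0 i| <= Num.max 1 M.
  move=> Ky i; rewrite le_max; apply/orP; right; apply: le_trans (KM _ Ky).
  by rewrite /Num.norm/= mx_normrE; exact: (le_bigmax _ _ (ord0, i)).
have Ko : K o by exact: interior_subset.
(* Halving [e] passes from the open ball to a closed one; the maxima ensure [rho <= D] and a
   positive [M]. *)
exists o, (e / 2), (Num.max (e / 2) (d%:R * (Num.max 1 M + Num.max 1 M))), (Num.max 1 M); split=> //.
- by rewrite divr_gt0//= le_max lexx.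
- move=> y /= yo; apply: eK; split=> [//|i j]; rewrite (ord1 i).
  rewrite /ball/= distrC; have := enorm_coord (y - o) j; rewrite !mxE.
  move=> /le_trans /(_ yo) /le_lt_trans; apply; lra.
- move=> y Ky; rewrite /eball/= le_max; apply/orP; right; apply: enorm_le_coord => i.
  by rewrite !mxE (le_trans (ler_normB _ _))// lerD// M1.
- by rewrite lt_max ltr01.
Qed.

Definition grid_cell (R : realType) d N (l M : R) (k : {ffun 'I_d -> 'I_N}) :
    set (d.-tuple R) :=
  [set x | forall i, (k i)%:R * l - M < tnth x i <= (k i).+1%:R * l - M].

Definition grid_size (R : realType) (l M : R) : nat := (Num.trunc (2 * M / l)).+1.

(** The cell of [c] has side [l], so it lies within [d * l <= delta] of [c], hence inside [K], and
    is hit by the sample. *)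
Lemma grid_dense (R : realType) d n (K : set 'rV[R]_d) (pts : 'I_n -> d.-tuple R)
    (l M delta : R) :
  0 < l -> (forall y, K y -> forall i, `|y ord0 i| <= M) -> d%:R * l <= delta ->
  (forall k : {ffun 'I_d -> 'I_(grid_size l M)},
    grid_cell l M k `<=` [set x | K (rv x)] -> exists i, grid_cell l M k (pts i)) ->
  forall c, eball c delta `<=` K -> exists i, eball c delta (rv (pts i)).
Proof.
move=> l0 KM ld hit c cK.
have delta0 : 0 <= delta by rewrite (le_trans _ ld)// mulr_ge0// ltW.
have Kc : K c.
  apply: cK; rewrite /eball/= (_ : c - c = 0 *: c) ?subrr ?scale0r//.
  by rewrite -(scale0r (0 : 'rV[R]_d)) enormZ normr0 mul0r.
have cM i : 0 <= c ord0 i + M <= 2 * M.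
  by have := KM _ Kc i; rewrite ler_norml => /andP[? ?]; apply/andP; split; lra.
pose k := [ffun i : 'I_d => inord (Num.trunc ((c ord0 i + M) / l)) : 'I_(grid_size l M)].
have kE i : k i = Num.trunc ((c ord0 i + M) / l) :> nat.
  rewrite ffunE inordK// ltnS.
  have /andP[c0 c2] := cM i.
  by apply: le_truncn; rewrite ler_pM2r ?invr_gt0.
(* Truncation may put [c] on a left face, which the cell excludes; still each coordinate of a point
   of the cell is within [l] of that of [c]. *)
have cell_ball : grid_cell l M k `<=` [set x | eball c delta (rv x)].
  move=> x /= xk; rewrite /eball/=; apply: le_trans ld; apply: enorm_le_coord => i.
  have /andP[c0 _] := cM i.
  have := xk i; rewrite kE.
  have /andP[] := truncn_itv (divr_ge0 c0 (ltW l0)).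
  rewrite ler_pdivlMr// ltr_pdivrMr// -[in X in _ -> X]natr1 !mxE ler_norml.
  by move=> t1 t2 /andP[t3 t4]; apply/andP; split; lra.
have [|i ik] := hit k; first by move=> x /cell_ball; exact: cK.
by exists i; exact: cell_ball.
Qed.

Lemma rips_contractible_of_dense (R : realType) d n (K : set 'rV[R]_d)
    (o : 'rV[R]_d) (rho D r delta : R) (pts : 'I_n -> d.-tuple R) :
  convex_subset K -> 0 < rho -> eball o rho `<=` K -> K `<=` eball o D -> rho <= D ->
  0 < r -> delta <= rho / (32 * D) * r -> (0 < n)%N ->
  (forall i, K (rv (pts i))) ->
  (forall c, eball c delta `<=` K -> exists i, eball c delta (rv (pts i))) ->
  contractible R (@geom_realization R n (rips_simplex pts r)).
Proof.
move=> Kc rho0 oK Ko rhoD r0 dr n0 Kpts dense.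
rewrite geom_realization_rips.
have -> : (fun i j => eucl_dist (pts i) (pts j) <= r) =
    rips_on (fun i => rv (pts i)) r [set: 'I_n]%SET.
  apply/funext => i; apply/funext => j.
  by rewrite /rips_on/= !finset.in_setT eucl_dist_enorm.
have rD : dismantlable (rips_on (fun i => rv (pts i)) r [set: 'I_n]%SET).
  apply: (@dismantlable_rips_on _ _ _ (fun i => rv (pts i)) K o rho D) => //.
  - move=> c cK; have [|i ic] := dense c.
      by apply: subset_trans cK => y /= /le_trans; apply.
    by exists i; exact: le_trans dr.
  - by apply/finset.set0Pn; exists (Ordinal n0); rewrite finset.in_setT.
  - by move=> i j _ _; rewrite finset.in_setT.
have [w ew] := dismantlable_vertex rD.
by apply: globally_contractible_contractible ew _; exact: dismantlable_contractible.
Qed.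

(** * Measurability of the events *)

Lemma measurable_eucl_dist_le (R : realType) d (dO : measure_display)
    (Omega : measurableType dO) (X Y : Omega -> d.-tuple R) (r : R) :
  measurable_fun setT X -> measurable_fun setT Y ->
  measurable [set w | eucl_dist (X w) (Y w) <= r].
Proof.
move=> mX mY.
have md : measurable_fun setT (fun w => eucl_dist (X w) (Y w)).
  apply: (@measurableT_comp _ _ _ _ _ _ (@Num.sqrt R)).
    by apply: continuous_measurable_fun => x; exact: sqrt_continuous.
  apply: measurable_sum => i; apply: measurable_funX; apply: measurable_funB.
    by apply: (measurableT_comp (f := fun x : d.-tuple R => tnth x i)) mX; exact: measurable_tnth.
  by apply: (measurableT_comp (f := fun x : d.-tuple R => tnth x i)) mY; exact: measurable_tnth.
by have := md measurableT _ (@measurable_itv R `]-oo, r]); rewrite setTI set_itvNyc.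
Qed.

Lemma measurable_finite_fibers (dO : measure_display) (Omega : measurableType dO)
    (T : finType) (h : Omega -> T) (Q : T -> Prop) :
  (forall t, measurable [set w | h w = t]) -> measurable [set w | Q (h w)].
Proof.
move=> mh; have -> : [set w | Q (h w)] = \bigcup_(t in [set t | Q t]) [set w | h w = t].
  apply/seteqP; split=> w /=; first by move=> Qw; exists (h w).
  by move=> [t /= Qt ->].
by apply: fin_bigcup_measurable => // t _; exact: mh.
Qed.

(** The event depends on the sample only through the finite table of comparisons of distances with
    [r], so it is a finite union of measurable fibres. *)
Lemma measurable_rips_contractible_event (R : realType) d (dO : measure_display)
    (Omega : measurableType dO) (X : nat -> Omega -> d.-tuple R) (n : nat) (r : R) :
  (forall i, measurable_fun setT (X i)) ->
  measurable (rips_contractible_event X n r).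
Proof.
move=> mX.
pose h w := [ffun ij : 'I_n * 'I_n => eucl_dist (X ij.1 w) (X ij.2 w) <= r].
pose Q (g : {ffun 'I_n * 'I_n -> bool}) :=
  contractible R (@clique_realization R n (fun i j => g (i, j))).
have -> : rips_contractible_event X n r = [set w | Q (h w)].
  apply: eq_set => w; rewrite geom_realization_rips /Q.
  by congr (contractible R (clique_realization _)); apply/funext => i; apply/funext => j; rewrite ffunE.
apply: measurable_finite_fibers => g.
have -> : [set w | h w = g] = \bigcap_(ij in [set: 'I_n * 'I_n])
    [set w | (eucl_dist (X ij.1 w) (X ij.2 w) <= r) = g ij].
  apply/seteqP; split=> w /=; first by move=> <- ij _; rewrite /= ffunE.
  by move=> gw; apply/ffunP => ij; rewrite ffunE; exact: gw.
apply: fin_bigcap_measurable => // ij _.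
have m := measurable_eucl_dist_le r (mX ij.1) (mX ij.2).
case: (g ij) => //.
rewrite (_ : mkset _ = ~` [set w | eucl_dist (X ij.1 w) (X ij.2 w) <= r]); first exact: measurableC.
by apply/seteqP; split=> w /=; [move=> ->|move/negP/negbTE].
Qed.

Lemma measurable_grid_cell (R : realType) d N (l M : R) (k : {ffun 'I_d -> 'I_N}) :
  measurable (grid_cell l M k).
Proof.
have -> : grid_cell l M k = \bigcap_(i in [set: 'I_d])
    ((fun x : d.-tuple R => tnth x i) @^-1` `](k i)%:R * l - M, (k i).+1%:R * l - M]%classic).
  apply/seteqP; split=> x /=; first by move=> xk i _; rewrite /= in_itv; exact: xk.
  by move=> xk i; have := xk i I; rewrite /= in_itv.
apply: fin_bigcap_measurable => // i _.
by rewrite -[X in measurable X]setTI; apply: measurable_tnth => //; exact: measurable_itv.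
Qed.

(** * Mass of the cells and probability of missing them *)

Lemma density_ge_on (R : realType) d (lam : {measure set (d.-tuple R) -> \bar R})
    (nu : probability (d.-tuple R) R) (f : d.-tuple R -> R) (m : R)
    (A : set (d.-tuple R)) :
  has_density lam nu f -> measurable A -> 0 <= m -> (forall x, A x -> m <= f x) ->
  (m%:E * lam A <= nu A)%E.
Proof.
move=> [mf f0 nuE] mA m0 Am; rewrite nuE// -(integral_cst lam mA m%:E).
apply: ge0_le_integral => //.
by apply/measurable_EFinP; exact: measurable_funTS.
Qed.

(** Since [f] vanishes outside [K], this puts all sample points in [K] almost surely; arguing with
    the zero set of [f] avoids the measurability of [K] itself. *)
Lemma density_eq0_null (R : realType) d (lam : {measure set (d.-tuple R) -> \bar R})
    (nu : probability (d.-tuple R) R) (f : d.-tuple R -> R) :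
  has_density lam nu f -> measurable [set x | f x = 0] /\ nu [set x | f x = 0] = 0%E.
Proof.
move=> [mf f0 nuE].
have mA : measurable [set x | f x = 0].
  by have := mf measurableT _ (measurable_set1 (0 : R)); rewrite setTI.
by split=> //; rewrite nuE// integral0_eq// => x /= ->.
Qed.

Lemma grid_cell_volume (R : realType) d N (l M : R) (k : {ffun 'I_d -> 'I_N})
   (lam : {measure set (d.-tuple R) -> \bar R}) :
  is_lebesgue_measure lam -> 0 <= l -> lam (grid_cell l M k) = (l ^+ d)%:E.
Proof.
move=> hlam l0.
pose a := [tuple (k i)%:R * l - M | i < d]; pose b := [tuple (k i).+1%:R * l - M | i < d].
have -> : grid_cell l M k = [set x | forall i, tnth a i < tnth x i <= tnth b i].
  by apply/seteqP; split=> x /= h i; have := h i; rewrite !tnth_mktuple.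
rewrite hlam; last by move=> i; rewrite !tnth_mktuple -natr1; nra.
congr (_%:E); under eq_bigr do rewrite !tnth_mktuple.
rewrite (eq_bigr (fun=> l)); last by move=> i _; rewrite -natr1; ring.
by rewrite prodr_const card_ord.
Qed.

(** By independence the probability is (1 - p)^n with p = nu(A) >= q, and 1 - q <= exp(- q). *)
Lemma void_probability_le (R : realType) d (dO : measure_display)
    (Omega : measurableType dO) (P : probability Omega R)
    (nu : probability (d.-tuple R) R) (X : nat -> Omega -> d.-tuple R)
    (n : nat) (A : set (d.-tuple R)) (q : R) :
  iid_with_law P nu X -> measurable A -> (q%:E <= nu A)%E ->
  measurable (\bigcap_(i in [set i | i \in iota 0 n]) (X i @^-1` ~` A)) /\
  (P (\bigcap_(i in [set i | i \in iota 0 n]) (X i @^-1` ~` A)) <= (expR (- (n%:R * q)))%:E)%E.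
Proof.
move=> [mX XP Xind] mA qA; split.
  apply: fin_bigcap_measurable => [|i _]; first exact: finite_seq.
  by rewrite -[X in measurable X]setTI; apply: mX => //; exact: measurableC.
rewrite (Xind _ (fun=> ~` A)) ?iota_uniq//; last by move=> _; exact: measurableC.
rewrite (eq_bigr (fun=> nu (~` A))); last first.
  by move=> i _; rewrite XP//; exact: measurableC.
have nuAfin : nu A \is a fin_num by exact: fin_num_measure.
have nuA1 := probability_le1 nu mA.
rewrite probability_setC//.
rewrite -(fineK nuAfin) in qA nuA1 *.
move: (fine _) qA nuA1 => p; rewrite !lee_fin => qp p1.
rewrite -EFinB; have -> : (\prod_(i <- iota 0 n) (1 - p)%:E)%E = ((1 - p) ^+ n)%:E.
  rewrite -[in RHS](size_iota 0 n); elim: (iota 0 n) => [|i s IH]; first by rewrite big_nil.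
  by rewrite big_cons IH -EFinM exprS.
rewrite lee_fin -mulrN expRM_natl.
case: n => [//|n].
rewrite ler_pXn2r// ?nnegrE ?expR_ge0 ?subr_ge0//.
by rewrite (le_trans _ (expR_ge1Dx _))// lerD2l lerN2.
Qed.

Lemma measure_bigcup_fintype_le (R : realType) (dO : measure_display)
    (Omega : measurableType dO) (P : {measure set Omega -> \bar R}) (I : finType)
    (A : I -> set Omega) (e : R) :
  (forall i, measurable (A i)) -> (forall i, P (A i) <= e%:E)%E ->
  (P (\bigcup_i A i) <= (#|I|%:R * e)%:E)%E.
Proof.
move=> mA PA.
have := @content_sub_fsum _ _ _ P I [set` enum I] (\bigcup_i A i) A.
rewrite -fsbig_seq ?enum_uniq// => h.
apply: (@le_trans _ _ (\sum_(i <- enum I) P (A i))%E).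
  apply: h => //.
  - by apply: fin_bigcup_measurable => // i _.
  - by move=> w [i _ Aw]; exists i => //=; rewrite mem_enum.
apply: (@le_trans _ _ (\sum_(i <- enum I) e%:E)%E); first exact: lee_sum.
by rewrite sumEFin lee_fin big_const_seq count_predT iter_addr_0 -cardE mulr_natl.
Qed.

(** * Asymptotics at the scale (ln n / n)^(1/d) *)

Definition rips_scale (R : realType) (d n : nat) : R :=
  powR (ln (n%:R) / n%:R) (d%:R^-1).

(** From 1/n = exp(- ln n) >= 1 - ln n one gets ln n >= 1 - 1/n >= 1/2. This bounds by 2 the factor
    1 / ln n coming from the number of cells. *)
Lemma ln_nat_ge_half (R : realType) (n : nat) : (1 < n)%N -> 1 / 2 <= ln (n%:R : R).
Proof.
move=> n1; have n0 : 0 < n%:R :> R by rewrite ltr0n (ltn_trans _ n1).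
have n2 : 2 <= n%:R :> R by rewrite ler_nat.
have : n%:R^-1 <= 1 / 2 :> R by rewrite div1r lef_pV2// posrE.
have := expR_ge1Dx (- ln (n%:R : R)); rewrite expRN lnK ?posrE//; lra.
Qed.

Lemma rips_scale_exp (R : realType) (d n : nat) : (0 < d)%N -> (1 < n)%N ->
  rips_scale R d n ^+ d = ln (n%:R) / n%:R.
Proof.
move=> d0 n1; rewrite /rips_scale -powR_mulrn ?powR_ge0// -powRrM mulVf ?pnatr_eq0 ?gtn_eqF//.
by rewrite powRr1// divr_ge0// ln_ge0// ler1n ltnW.
Qed.

Lemma rips_scale_gt0 (R : realType) (d n : nat) : (1 < n)%N -> 0 < rips_scale R d n.
Proof.
by move=> n1; rewrite powR_gt0// divr_gt0// ?ln_gt0 ?ltr1n// ltr0n ltnW.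
Qed.

Lemma rips_scale_le1 (R : realType) (d n : nat) : (0 < d)%N -> (1 < n)%N ->
  rips_scale R d n <= 1.
Proof.
move=> d0 n1; have n0 : 0 < n%:R :> R by rewrite ltr0n ltnW.
rewrite -(@ler_pXn2r _ d)// ?nnegrE ?(ltW (rips_scale_gt0 _ _ n1))//.
rewrite rips_scale_exp// expr1n ler_pdivrMr// mul1r; exact: ltW (ln_sublinear n0).
Qed.

(** There are at most ((2M + b)/l)^d cells, a constant times n / ln n. As n m l^d = m b^d ln n >= 2
    ln n, each term is at most n^-2. *)
Lemma grid_union_bound (R : realType) (d n : nat) (m b M l : R) :
  (0 < d)%N -> (1 < n)%N -> 0 < m -> 0 < b -> 0 < M -> 2 <= m * b ^+ d ->
  l = b * rips_scale R d n ->
  (grid_size l M ^ d)%:R * expR (- (n%:R * (m * l ^+ d))) <=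
    2 * ((2 * M + b) / b) ^+ d / n%:R.
Proof.
move=> d0 n1 m0 b0 M0 mb ldef.
have n0 : 0 < n%:R :> R by rewrite ltr0n ltnW.
have L0 := ln_nat_ge_half R n1.
have s0 := rips_scale_gt0 R d n1.
have l0 : 0 < l by rewrite ldef mulr_gt0.
have lb : l <= b by rewrite ldef ler_piMr ?rips_scale_le1// ltW.
have lE : l ^+ d = b ^+ d * (ln n%:R / n%:R) by rewrite ldef exprMn rips_scale_exp.
have gl : (grid_size l M)%:R <= (2 * M + b) / l.
  rewrite /grid_size -[leLHS]natr1 [leRHS]mulrDl lerD//; last by rewrite ler_pdivlMr ?mul1r.
  by have /andP[] := truncn_itv (divr_ge0 (mulr_ge0 (ler0n R 2) (ltW M0)) (ltW l0)).
have gld : (grid_size l M ^ d)%:R <= ((2 * M + b) / b) ^+ d * (n%:R / ln n%:R) :> R.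
  rewrite natrX (le_trans (y := ((2 * M + b) / l) ^+ d))//.
    by rewrite ler_pXn2r// nnegrE// (le_trans _ gl).
  rewrite !expr_div_n lE le_eqVlt; apply/orP; left; apply/eqP.
  by field; rewrite expf_eq0 !gt_eqF ?andbF//; lra.
have el : expR (- (n%:R * (m * l ^+ d))) <= (n%:R ^+ 2)^-1.
  rewrite -[n%:R in leRHS](@lnK R) ?posrE// -expRM_natl -expRN ler_expR lerN2 lE.
  have -> : n%:R * (m * (b ^+ d * (ln n%:R / n%:R))) = m * b ^+ d * ln n%:R.
    by field; rewrite gt_eqF.
  by rewrite ler_wpM2r//; lra.
apply: le_trans (ler_pM (ler0n _ _) (expR_ge0 _) gld el) _.
set A := _ ^+ d.
have A0 : 0 < A by rewrite exprn_gt0// divr_gt0// addr_gt0// mulr_gt0.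
have -> : A * (n%:R / ln n%:R) * (n%:R ^+ 2)^-1 = A * (ln n%:R)^-1 / n%:R.
  by field; rewrite !gt_eqF//; lra.
rewrite ler_pM2r ?invr_gt0// (mulrC 2) ler_pM2l//.
by rewrite -[leRHS]invrK lef_pV2 ?posrE//; lra.
Qed.

(** * Combination of the geometric and probabilistic estimates *)

Theorem theorem1p1 (R : realType) (d : nat) (hd : (0 < d)%N)
    (K : set 'rV[R]_d) (hK : convex_body K)
    (lam : {measure set (d.-tuple R) -> \bar R}) (hlam : is_lebesgue_measure lam)
    (nu : probability (d.-tuple R) R) (f : d.-tuple R -> R)
    (hf : has_density lam nu f)
    (hsupp : forall x, ~ K (rv x) -> f x = 0)
    (hinf : exists m : R, 0 < m /\ forall x, K (rv x) -> m <= f x) :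
  exists c : R,
    forall r : nat -> R,
      (forall n : nat, (1 < n)%N ->
         c * powR (ln (n%:R) / n%:R) (d%:R^-1) <= r n) ->
      forall (dO : measure_display) (Omega : measurableType dO)
             (P : probability Omega R) (X : nat -> Omega -> d.-tuple R),
        iid_with_law P nu X ->
        (forall n, measurable (rips_contractible_event X n (r n))) /\
        ((fun n => P (rips_contractible_event X n (r n))) @ \oo --> 1%:E).
Proof.
have [m [m0 fm]] := hinf.
have Kconv : convex_subset K by case: hK.
have [z0 [rho [D [M [/andP[rho0 rhoD] oK Ko M0 KM]]]]] := convex_body_bounds hK.
have D0 : 0 < D := lt_le_trans rho0 rhoD.
(* Then [m * b >= 2], and [b >= 1] gives [b ^+ d >= b] for [d > 0]. *)
pose b := 1 + 2 / m.
have b1 : 1 <= b by rewrite lerDl divr_ge0// ltW.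
have b0 : 0 < b := lt_le_trans ltr01 b1.
have mb : 2 <= m * b ^+ d.
  apply: (@le_trans _ _ (m * b)).
    by rewrite /b mulrDr mulrCA divff ?gt_eqF// mulr1 mulr1 lerDr ltW.
  by rewrite ler_pM2l// -[leLHS]expr1 ler_weXn2l.
pose eta := rho / (32 * D).
have eta0 : 0 < eta by rewrite divr_gt0// mulr_gt0.
(* With cells of side [l = b * rips_scale R d n] this constant gives [d * l <= eta * r n], the
   density needed at scale [r n]. *)
exists (d%:R * b / eta) => r hr dO Omega P X hX.
have [mX XP Xind] := hX.
have mE n : measurable (rips_contractible_event X n (r n)).
  exact: measurable_rips_contractible_event.
split=> //.
pose C : R := 2 * ((2 * M + b) / b) ^+ d.
have C0 : 0 <= C by rewrite mulr_ge0// exprn_ge0// divr_ge0// ?(ltW b0)// addr_ge0// ?(ltW b0)// mulr_ge0// ltW.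
have PE n : (1 < n)%N -> ((1 - C / n%:R)%:E <= P (rips_contractible_event X n (r n)))%E.
  move=> n1; set E := rips_contractible_event X n (r n).
  pose l := b * rips_scale R d n.
  have l0 : 0 < l by rewrite mulr_gt0// rips_scale_gt0.
  have rl : d%:R * l <= eta * r n.
    have := hr n n1; rewrite -/(rips_scale R d n) -(ler_pM2l eta0).
    by congr (_ <= _); rewrite /l; field; rewrite gt_eqF.
  have r0 : 0 < r n.
    by rewrite -(pmulr_rgt0 _ eta0) (lt_le_trans _ rl)// mulr_gt0// ltr0n.
  pose cell (k : {ffun 'I_d -> 'I_(grid_size l M)}) := grid_cell l M k.
  pose inK k := cell k `<=` [set x | K (rv x)].
  pose void A := \bigcap_(i in [set i | i \in iota 0 n]) (X i @^-1` ~` A).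
  (* Cells not contained in [K] contribute no bad event, so the union may run over the whole
     grid. *)
  pose V k := if `[< inK k >] then void (cell k) else set0.
  pose U (i : 'I_n) := X i @^-1` [set x | f x = 0].
  have [mf0 nuf0] := density_eq0_null hf.
  have cellP k : inK k -> measurable (void (cell k)) /\
      (P (void (cell k)) <= (expR (- (n%:R * (m * l ^+ d))))%:E)%E.
    move=> kK; apply: (void_probability_le n (A := cell k) (q := m * l ^+ d) hX); first exact: measurable_grid_cell.
    rewrite EFinM -(grid_cell_volume M k hlam (ltW l0)).
    by apply: (density_ge_on hf) => // [||x /kK /fm//]; [exact: measurable_grid_cell|exact: ltW].
  have mV k : measurable (V k).
    by rewrite /V; case: asboolP => // /cellP[].
  have PV : (P (\bigcup_k V k) <= (C / n%:R)%:E)%E.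
    apply: (@le_trans _ _ (#|{ffun 'I_d -> 'I_(grid_size l M)}|%:R *
        expR (- (n%:R * (m * l ^+ d))))%:E).
      apply: measure_bigcup_fintype_le => // k.
      rewrite /V; case: asboolP => [/cellP[]//|_].
      by rewrite measure0 lee_fin expR_ge0.
    by rewrite lee_fin card_ffun !card_ord; exact: grid_union_bound.
  have mU i : measurable (U i).
    by rewrite -[X in measurable X]setTI; exact: mX.
  have PU : (P (\bigcup_i U i) <= 0)%E.
    have PU0 i : (P (U i) <= 0%:E)%E by rewrite XP// nuf0.
    by have := @measure_bigcup_fintype_le _ _ _ P _ U 0 mU PU0; rewrite mulr0.
  (* Outside the bad events every sample point is in [K] and every cell inside [K] is hit, so the
     deterministic criterion applies. *)
  have bad : ~` E `<=` (\bigcup_i U i) `|` (\bigcup_k V k).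
    move=> w /= Ew; apply: contrapT => /not_orP[wU wV]; apply: Ew.
    have KX (i : 'I_n) : K (rv (X i w)).
      by apply: contrapT => /hsupp Xi0; apply: wU; exists i.
    rewrite /E /rips_contractible_event/=.
    apply: (rips_contractible_of_dense Kconv rho0 oK Ko rhoD r0 (lexx _)) => //.
      exact: ltnW.
    apply: (grid_dense l0 KM rl) => k kK.
    apply: contrapT => /forallNP noX; apply: wV; exists k => //.
    rewrite /V; case: asboolP => // _ i /=.
    by rewrite mem_iota add0n => /= lt_in; exact: (noX (Ordinal lt_in)).
  have mbU : measurable (\bigcup_i U i) by apply: fin_bigcup_measurable => // i _; exact: mU.
  have mbV : measurable (\bigcup_k V k) by apply: fin_bigcup_measurable => // k _; exact: mV.
  have mUV : measurable ((\bigcup_i U i) `|` (\bigcup_k V k)).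
    exact: measurableU.
  have PnE : (P (~` E) <= (C / n%:R)%:E)%E.
    apply: (@le_trans _ _ (P ((\bigcup_i U i) `|` (\bigcup_k V k)))).
      by apply: le_measure => //; apply/mem_set => //; exact/measurableC/mE.
    apply: (le_trans (measureU2 _ mbU mbV)).
    by rewrite -[leRHS]add0e leeD.
  move: PnE; rewrite probability_setC//; last exact: mE.
  have PEfin : P E \is a fin_num by apply: fin_num_measure; exact: mE.
  rewrite -(fineK PEfin) -EFinB !lee_fin; lra.
(* [harmonic n] is 1/(n+1), and C/n <= 2C/(n+1) for n >= 1; the bound [PE] needs n > 1, which holds
   eventually. *)
apply: (@squeeze_cvge _ _ _ _ (fun n => (1 - 2 * C * harmonic n)%:E) _ (cst 1%:E)).
- near=> n; rewrite probability_le1// andbT.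
  have n1 : (1 < n)%N by near: n; exact: nbhs_infty_gt.
  apply: le_trans (PE n n1); rewrite lee_fin lerD2l lerN2 /harmonic.
  have n1R : 1 <= n%:R :> R by rewrite ler1n ltnW.
  rewrite [leRHS](_ : _ = C * (2 / n.+1%:R)); last by rewrite /=; ring.
  rewrite ler_wpM2l// ler_pdivlMr// mulrC ler_pdivrMr; last by lra.
  by rewrite -natr1; lra.
- apply: cvg_EFin; first by near=> n.
  rewrite -[X in _ --> X]subr0 -(mulr0 (2 * C)).
  apply: cvgB; first exact: cvg_cst.
  by apply: cvgMl_tmp; exact: cvg_harmonic.
- exact: cvg_cst.
Unshelve. all: by end_near.
Qed.
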